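(* Let $\zeta$ be a limit ordinal and let $(\alpha_\gamma)_{\gamma<\zeta}$ be a sequence of ordinals which is not eventually zero (i.e., for every $\delta<\zeta$ there is $\gamma$ with $\delta\le\gamma<\zeta$ and $\alpha_\gamma\neq 0$). Then $\bigoplus_{\gamma<\zeta}\alpha_\gamma\neq 0$; let $\xi$ be its smallest exponent. Then there is $\bar\gamma<\zeta$ such that for every ordinal $\varepsilon$ with $\bar\gamma\le\varepsilon<\zeta$: \[ \bigoplus_{\varepsilon\le\gamma<\zeta}\alpha_\gamma=\sum_{\varepsilon\le\gamma<\zeta}\alpha_\gamma=\omega^\xi \quad\text{and}\quad \bigoplus_{\gamma<\zeta}\alpha_\gamma=\Big(\bigoplus_{\gamma<\varepsilon}\alpha_\gamma\Big)+\omega^\xi. \]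
   Context: All sums, products and powers of ordinals are ordinal operations. Every nonzero ordinal $\alpha$ has a unique Cantor normal form $\alpha=\omega^{\xi_k}r_k+\dots+\omega^{\xi_0}r_0$ with $\xi_k>\dots>\xi_0$ and $0<r_i<\omega$; $\xi_0$ is called the smallest exponent of $\alpha$. The (Hessenberg) natural sum $\alpha\oplus\beta$ is defined by writing $\alpha=\sum_{j}\omega^{\eta_j}r_j$ and $\beta=\sum_j\omega^{\eta_j}s_j$ in Cantor normal form over a common decreasing finite list of exponents $\eta_j$ (allowing zero coefficients) and setting $\alpha\oplus\beta=\sum_j\omega^{\eta_j}(r_j+s_j)$. For a sequence of ordinals $(\alpha_\gamma)$ and an ordinal $\delta$, the iterated natural sum is defined by recursion: $\bigoplus_{\gamma<0}\alpha_\gamma=0$, $\bigoplus_{\gamma<\delta+1}\alpha_\gamma=(\bigoplus_{\gamma<\delta}\alpha_\gamma)\oplus\alpha_\delta$, and $\bigoplus_{\gamma<\delta}\alpha_\gamma=\sup_{\delta'<\delta}\bigoplus_{\gamma<\delta'}\alpha_\gamma$ for limit $\delta$. The ordinary transfinite sum $\sum_{\gamma<\delta}\alpha_\gamma$ is defined by the same recursion with ordinal $+$ in place of $\oplus$ at successor steps. For $\delta'\le\delta$, letting $\eta$ be the unique ordinal with $\delta'+\eta=\delta$, set $\bigoplus_{\delta'\le\gamma<\delta}\alpha_\gamma=\bigoplus_{\varepsilon<\eta}\alpha_{\delta'+\varepsilon}$, and similarly $\sum_{\delta'\le\gamma<\delta}\alpha_\gamma=\sum_{\varepsilon<\eta}\alpha_{\delta'+\varepsilon}$.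 *)

(* Defs.v *)
From HB Require Import structures.
From mathcomp Require Import all_boot.
From mathcomp Require Import boolp.

Set Implicit Arguments.
Unset Strict Implicit.
Unset Printing Implicit Defensive.

(* Ordinals. A well-founded tree [Node A f] codes the ordinal
   sup_(a : A) (f a + 1); every ordinal that is the order type of a well-order
   on some type is coded in this way. An element of [ord] is a class of trees
   that code the same ordinal, so equality of ordinals is Leibniz equality. *)
Inductive tree : Type := Node (A : Type) of A -> tree.

Fixpoint tle (x y : tree) {struct x} : Prop :=
  match x, y with
  | Node A f, Node B g => forall a, exists b, tle (f a) (g b)
  end.

Definition tlt (x y : tree) : Prop :=
  match y with Node B g => exists b, tle x (g b) end.

Definition teq (x y : tree) : Prop := tle x y /\ tle y x.

Definition ord : Type := {P : tree -> Prop | exists x, P = teq x}.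

Definition mk_ord (x : tree) : ord := exist _ (teq x) (ex_intro _ x erefl).
Definition ord_repr (a : ord) : tree := projT1 (cid (proj2_sig a)).

HB.instance Definition _ := gen_eqMixin ord.

Definition ole (a b : ord) : Prop := tle (ord_repr a) (ord_repr b).
Definition olt (a b : ord) : Prop := tlt (ord_repr a) (ord_repr b).

Declare Scope ord_scope.
Delimit Scope ord_scope with ord.
Bind Scope ord_scope with ord.
Local Open Scope ord_scope.

Notation "a <= b" := (ole a b) : ord_scope.
Notation "a < b" := (olt a b) : ord_scope.

Lemma tleP (A : Type) (f : A -> tree) y :
  tle (Node f) y <-> forall a, tlt (f a) y.
Proof. by case: y. Qed.

Lemma tle_refl x : tle x x.
Proof. by elim: x => A f IH /= a; exists a. Qed.

Lemma tle_trans x y z : tle x y -> tle y z -> tle x z.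
Proof.
elim: x y z => A f IH [B g] [C h] /= xy yz a.
have [b ab] := xy a; have [c bc] := yz b.
by exists c; apply: IH ab bc.
Qed.

Lemma tle_lt_trans x y z : tle x y -> tlt y z -> tlt x z.
Proof. by case: z => C h xy [c yc]; exists c; apply: tle_trans yc. Qed.

Lemma tlt_le_trans x y z : tlt x y -> tle y z -> tlt x z.
Proof.
case: y => B g [b xb] /tleP /(_ b); exact: tle_lt_trans xb.
Qed.

Lemma tltxx x : ~ tlt x x.
Proof.
elim: x => A f IH [a] /tleP/(_ a); exact: IH.
Qed.

Lemma tle_or_lt x y : tle x y \/ tlt y x.
Proof.
suff: (tle x y \/ tlt y x) /\ (tle y x \/ tlt x y) by case.
elim: x y => A f IHx; elim=> B g IHy; split.
- case: (pselect (forall a, tlt (f a) (Node g))) => [/tleP|/existsNP[a na]].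
    by left.
  by right; exists a; have [_ []] := IHx a (Node g).
- case: (pselect (forall b, tlt (g b) (Node f))) => [/tleP|/existsNP[b nb]].
    by left.
  by right; exists b; have [[]] := IHy b.
Qed.

Lemma tlt_wf : well_founded tlt.
Proof.
move=> x; suff: forall y, tle y x -> Acc tlt y by apply; exact: tle_refl.
elim: x => A f IH y yx; constructor=> z zy.
have [a za] := tlt_le_trans zy yx; exact: IH za.
Qed.

Lemma teq_repr_mk x : teq x (ord_repr (mk_ord x)).
Proof.
rewrite /ord_repr; case: cid => y /= ->; by split; apply: tle_refl.
Qed.

Lemma reprK a : mk_ord (ord_repr a) = a.
Proof.
rewrite /ord_repr; case: cid => y; case: a => P p /= E; exact: eq_exist.
Qed.

Lemma ole_mk x y : mk_ord x <= mk_ord y <-> tle x y.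
Proof.
rewrite /ole; have [x1 x2] := teq_repr_mk x; have [y1 y2] := teq_repr_mk y.
split=> h.
  by apply: tle_trans y2; apply: tle_trans h.
by apply: tle_trans y1; apply: tle_trans h.
Qed.

Lemma olt_mk x y : mk_ord x < mk_ord y <-> tlt x y.
Proof.
rewrite /olt; have [x1 x2] := teq_repr_mk x; have [y1 y2] := teq_repr_mk y.
split=> h.
  by apply: tlt_le_trans y2; apply: tle_lt_trans h.
by apply: tlt_le_trans y1; apply: tle_lt_trans h.
Qed.

Lemma olexx a : a <= a. Proof. exact: tle_refl. Qed.
Lemma ole_trans b a c : a <= b -> b <= c -> a <= c.
Proof. exact: tle_trans. Qed.
Lemma ole_lt_trans b a c : a <= b -> b < c -> a < c.
Proof. exact: tle_lt_trans. Qed.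
Lemma olt_le_trans b a c : a < b -> b <= c -> a < c.
Proof. exact: tlt_le_trans. Qed.
Lemma oltxx a : ~ a < a. Proof. exact: tltxx. Qed.
Lemma ole_or_lt a b : a <= b \/ b < a. Proof. exact: tle_or_lt. Qed.

Lemma olt_wf : well_founded olt.
Proof.
suff H : forall x a, ord_repr a = x -> Acc olt a by move=> a; exact: H erefl.
elim/(well_founded_ind tlt_wf) => x IH a E; constructor=> b ba.
by apply: (IH (ord_repr b)) => //; rewrite -E.
Qed.

Lemma oltW a b : a < b -> a <= b.
Proof.
rewrite /olt /ole; elim: (ord_repr a) (ord_repr b) => A f IH [B g] [b0 xb] /= a0.
exists b0; apply: IH; exact: (proj1 (tleP f (g b0)) xb).
Qed.

Lemma olt_trans b a c : a < b -> b < c -> a < c.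
Proof. by move=> /oltW; exact: ole_lt_trans. Qed.

Lemma ole_anti a b : a <= b -> b <= a -> a = b.
Proof.
move=> ab ba; rewrite -[a]reprK -[b]reprK; apply: eq_exist.
apply: funext => x; apply: propext; rewrite /teq.
split=> -[h1 h2].
  by split; [apply: tle_trans ba h1|apply: tle_trans h2 ab].
by split; [apply: tle_trans ab h1|apply: tle_trans h2 ba].
Qed.

Lemma oleNgt a b : a <= b <-> ~ b < a.
Proof.
split=> [ab ba|]; first by apply: (@oltxx a); exact: ole_lt_trans ba.
by case: (ole_or_lt a b).
Qed.

Lemma oltNge a b : a < b <-> ~ b <= a.
Proof.
split=> [ab ba|]; first by apply: (@oltxx a); exact: olt_le_trans ba.
by case: (ole_or_lt b a).
Qed.

Lemma ole_eqVlt a b : a <= b -> a = b \/ a < b.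
Proof.
by move=> ab; case: (ole_or_lt b a) => [ba|]; [left; exact: ole_anti|right].
Qed.

Lemma oltgtP a b : [\/ a < b, a = b | b < a].
Proof.
case: (ole_or_lt a b) => [/ole_eqVlt[]|]; by [constructor 1|constructor 2|constructor 3].
Qed.

Lemma olt_neq a b : a < b -> a <> b.
Proof. by move=> ab E; apply: (@oltxx b); rewrite -{1}E. Qed.

Definition ozero : ord := mk_ord (Node (of_void tree)).
Notation "0" := ozero : ord_scope.

Lemma ole0x a : 0 <= a.
Proof. by rewrite -[a]reprK; apply/ole_mk/tleP. Qed.

Lemma oltx0 a : ~ a < 0.
Proof. by apply/oleNgt/ole0x. Qed.

Lemma olt0x a : a <> 0 -> 0 < a.
Proof. by move=> a0; case/ole_eqVlt: (ole0x a) => // /esym. Qed.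

(* Least element of a class of ordinals; 0 for the empty class. *)
Definition omin (P : ord -> Prop) : ord :=
  match pselect (exists a, P a /\ forall b, P b -> a <= b) with
  | left e => projT1 (cid e)
  | right _ => 0
  end.

Lemma ominP (P : ord -> Prop) :
  (exists a, P a) -> P (omin P) /\ forall b, P b -> omin P <= b.
Proof.
move=> [a Pa]; rewrite /omin; case: pselect => [e|ne]; first by case: cid.
case: ne; apply: contrapT => ne; elim/(well_founded_ind olt_wf): a Pa => a IH Pa.
apply: ne; exists a; split=> // b Pb; apply/oleNgt => ba; exact: IH ba Pb.
Qed.

(* Every family of ordinals indexed by a type has a strict upper bound. *)
Lemma small_bounded (A : Type) (f : A -> ord) : exists b, forall a, f a < b.
Proof.
exists (mk_ord (Node (fun a => ord_repr (f a)))) => a.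
rewrite -[f a]reprK; apply/olt_mk; by exists a; exact: tle_refl.
Qed.

Fixpoint tindex (t : tree) : Type :=
  match t with Node A f => {a : A & option (tindex (f a))} end.

Fixpoint subtree (t : tree) : tindex t -> tree :=
  match t with
  | Node A f => fun i =>
      let: existT a o := i in
      if o is Some j then @subtree (f a) j else f a
  end.

Lemma subtree_onto t x : tlt x t -> exists i, teq x (@subtree t i).
Proof.
elim: t => A f IH [a xa]; case: (tle_or_lt (f a) x) => [ax|/IH[j xj]].
  by exists (existT _ a None); split.
by exists (existT _ a (Some j)).
Qed.

(* Replacement: the image of an initial segment is bounded. *)
Lemma image_bounded (F : ord -> ord) d :
  exists b, forall e, e < d -> F e <= b.
Proof.
have [b Hb] := small_bounded (fun i => F (mk_ord (@subtree (ord_repr d) i))).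
exists b => e /subtree_onto[i [h1 h2]].
suff -> : e = mk_ord (subtree i) by exact/oltW.
by apply: ole_anti; rewrite -[e]reprK; apply/ole_mk.
Qed.

Definition osucc (a : ord) : ord := omin (fun b => a < b).

Definition osup (P : ord -> Prop) : ord :=
  omin (fun b => forall a, P a -> a <= b).

Definition is_limit (a : ord) : Prop := a <> 0 /\ forall b, a <> osucc b.

Lemma osuccP a : a < osucc a /\ forall b, a < b -> osucc a <= b.
Proof.
apply: ominP; have [b Hb] := small_bounded (fun _ : unit => a).
by exists b; apply: Hb.
Qed.

Lemma olt_succ a : a < osucc a. Proof. by case: (osuccP a). Qed.

Lemma osucc_le a b : osucc a <= b <-> a < b.
Proof.
by split=> [|/(proj2 (osuccP a))//]; apply: olt_le_trans (olt_succ a).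
Qed.

Lemma olt_succE a b : a < osucc b <-> a <= b.
Proof.
split=> [ab|ab]; last by apply: ole_lt_trans (olt_succ b).
by apply/oleNgt => /osucc_le /oleNgt.
Qed.

Lemma osucc_inj a b : osucc a = osucc b -> a = b.
Proof.
by move=> E; apply: ole_anti; apply/olt_succE; [rewrite -E|rewrite E];
  apply: olt_succ.
Qed.

Lemma osucc_neq0 a : osucc a <> 0.
Proof. by move=> E; apply: (@oltx0 a); rewrite -E; apply: olt_succ. Qed.

Lemma limit_succ l a : is_limit l -> a < l -> osucc a < l.
Proof.
by move=> [_ h] /osucc_le /ole_eqVlt [/esym E|//]; case: (h a).
Qed.

Lemma ord_cases a : [\/ a = 0, exists b, a = osucc b | is_limit a].
Proof.
case: (pselect (a = 0)) => [->|a0]; first by constructor 1.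
case: (pselect (exists b, a = osucc b)) => [h|h]; first by constructor 2.
by constructor 3; split=> // b E; apply: h; exists b.
Qed.

Lemma ord_ind (P : ord -> Prop) :
  P 0 -> (forall a, P a -> P (osucc a)) ->
  (forall l, is_limit l -> (forall a, a < l -> P a) -> P l) -> forall a, P a.
Proof.
move=> P0 PS PL; elim/(well_founded_ind olt_wf) => a IH.
case: (ord_cases a) => [->//|[b E]|/PL]; last exact.
by rewrite E; apply: PS; apply: IH; rewrite E; apply: olt_succ.
Qed.

Lemma osup_ub (P : ord -> Prop) b a :
  (forall a, P a -> a <= b) -> P a -> a <= osup P.
Proof.
move=> h.
by have [H _] := @ominP (fun c => forall a, P a -> a <= c) (ex_intro _ b h); apply: H.
Qed.

Lemma osup_le (P : ord -> Prop) b :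
  (forall a, P a -> a <= b) -> osup P <= b.
Proof.
move=> h.
by have [_ H] := @ominP (fun c => forall a, P a -> a <= c) (ex_intro _ b h); apply: H.
Qed.

(* Extension by the junk value 0 of a function defined below [d]. *)
Definition extend0 (d : ord) (r : forall e, e < d -> ord) (e : ord) : ord :=
  match pselect (e < d) with left h => r e h | right _ => 0 end.

(* For a successor [d], its predecessor. *)
Definition opred (d : ord) : ord := omin (fun e => d = osucc e).

(* Transfinite recursion: value [z] at 0, [s d r] at the successor of [d] when
   [r] is the value at [d], supremum of the previous values at limits. *)
Definition ord_step (z : ord) (s : ord -> ord -> ord) (d : ord)
    (r : ord -> ord) : ord :=
  if `[< d = 0 >] then z
  else if `[< exists e, d = osucc e >] then s (opred d) (r (opred d))
  else osup (fun a => exists2 e, e < d & a = r e).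

Definition ord_rec (z : ord) (s : ord -> ord -> ord) : ord -> ord :=
  Fix olt_wf (fun=> ord) (fun d r => ord_step z s d (extend0 r)).

Lemma ord_recE z s d :
  ord_rec z s d = ord_step z s d (extend0 (fun e (_ : e < d) => ord_rec z s e)).
Proof.
rewrite /ord_rec Fix_eq // => x f g fg; congr (ord_step z s x _).
by apply: funext => e; rewrite /extend0; case: pselect.
Qed.

Lemma ord_rec0 z s : ord_rec z s 0 = z.
Proof. by rewrite ord_recE /ord_step asboolT. Qed.

Lemma ord_recS z s d : ord_rec z s (osucc d) = s d (ord_rec z s d).
Proof.
have -> : ord_rec z s (osucc d) = ord_step z s (osucc d) (ord_rec z s).
  rewrite ord_recE /ord_step; case: asboolP => // _; case: asboolP => [h|h].
    congr s; rewrite /extend0; case: pselect => // -[].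
    have [E _] : osucc d = osucc (opred (osucc d)) /\ _ := ominP h.
    by rewrite {2}E; apply: olt_succ.
  by case: h; exists d.
rewrite /ord_step asboolF; last exact: osucc_neq0.
have h : exists e, osucc d = osucc e by exists d.
rewrite asboolT //; have [/osucc_inj E _] := ominP h.
by rewrite -[opred _]E.
Qed.

Lemma ord_recL z s d : is_limit d ->
  ord_rec z s d = osup (fun a => exists2 e, e < d & a = ord_rec z s e).
Proof.
move=> [d0 dS]; rewrite ord_recE /ord_step asboolF // asboolF; last first.
  by move=> [e]; apply: dS.
congr osup; apply: funext => a; apply: propext; rewrite /extend0.
by split=> -[e ed ->]; exists e => //; case: pselect.
Qed.

Definition oadd (a b : ord) : ord := ord_rec a (fun _ r => osucc r) b.
Notation "a + b" := (oadd a b) : ord_scope.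

Definition omul (a b : ord) : ord := ord_rec 0 (fun _ r => r + a) b.
Notation "a * b" := (omul a b) : ord_scope.

Definition ofnat (n : nat) : ord := iter n osucc 0.

Definition omega : ord := osup (fun a => exists n, a = ofnat n).

(* [wpow x] is the power omega^x. *)
Definition wpow (x : ord) : ord := ord_rec (ofnat 1) (fun _ r => r * omega) x.

Lemma ord_recL_ub z s l e : is_limit l -> e < l -> ord_rec z s e <= ord_rec z s l.
Proof.
move=> ll el; rewrite (ord_recL z s ll).
have [b Hb] := image_bounded (ord_rec z s) l.
by apply: (@osup_ub _ b) => [_ [x xl ->]|]; [exact: Hb|exists e].
Qed.

Lemma ord_recL_le z s l b : is_limit l ->
  (forall e, e < l -> ord_rec z s e <= b) -> ord_rec z s l <= b.
Proof.
by move=> ll h; rewrite ord_recL //; apply: osup_le => _ [e el ->]; exact: h.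
Qed.

Lemma ord_rec_mono z s : (forall d, ord_rec z s d <= ord_rec z s (osucc d)) ->
  forall a b, a <= b -> ord_rec z s a <= ord_rec z s b.
Proof.
move=> h a; elim/ord_ind => [|b IH|l ll IH] /ole_eqVlt[->|]; try exact: olexx.
- by move/oltx0.
- by move/olt_succE/IH => ab; apply: ole_trans ab (h _).
- exact: ord_recL_ub.
Qed.

Definition normal (f : ord -> ord) : Prop :=
  (forall a b, a < b -> f a < f b) /\
  (forall l x, is_limit l -> (forall e, e < l -> f e <= x) -> f l <= x).

Lemma ord_rec_normal z s : (forall d, ord_rec z s d < ord_rec z s (osucc d)) ->
  normal (ord_rec z s).
Proof.
move=> h; split=> [a b /osucc_le ab|l x ll]; last exact: ord_recL_le.
apply: olt_le_trans (h a) _; apply: ord_rec_mono ab => d; exact/oltW.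
Qed.

Lemma normal_le f a b : normal f -> a <= b -> f a <= f b.
Proof.
by move=> [h _] /ole_eqVlt[->|/h/oltW //]; apply: olexx.
Qed.

Lemma normal_inj f a b : normal f -> f a = f b -> a = b.
Proof.
by move=> [h _] E; case: (oltgtP a b) => // /h /olt_neq; rewrite E.
Qed.

Lemma normal_lt f a b : normal f -> f a < f b -> a < b.
Proof.
by move=> nf h; apply/oltNge => /(normal_le nf) /oleNgt.
Qed.

Lemma normal_ge f a : normal f -> a <= f a.
Proof.
move=> nf; elim/(well_founded_ind olt_wf): a => a IH; apply/oleNgt => fa.
by move/oleNgt: (IH _ fa); apply; apply: (proj1 nf).
Qed.

Lemma normal_floor f a : normal f -> f 0 <= a ->
  exists x, f x <= a /\ a < f (osucc x).
Proof.
move=> nf f0.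
have [|h1 h2] := @ominP (fun x => a < f x).
  exists (osucc a); apply: olt_le_trans (olt_succ a) _; exact: normal_ge.
move: h1 h2; set m := omin _; move: m => m h1 h2.
case: (ord_cases m) => [E|[b E]|lm].
- by move/oltNge: h1; rewrite E.
- exists b; rewrite -E; split=> //; apply/oleNgt => /h2 /oleNgt; apply.
  by rewrite E; apply: olt_succ.
- move/oltNge: h1; case; apply: (proj2 nf) => // e em.
  by apply/oleNgt => /h2 /oleNgt.
Qed.

Lemma oaddx0 a : a + 0 = a. Proof. exact: ord_rec0. Qed.
Lemma oaddxS a b : a + osucc b = osucc (a + b). Proof. exact: ord_recS. Qed.
Lemma omulx0 a : a * 0 = 0. Proof. exact: ord_rec0. Qed.
Lemma omulxS a b : a * osucc b = a * b + a. Proof. exact: ord_recS. Qed.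
Lemma wpow0 : wpow 0 = ofnat 1. Proof. exact: ord_rec0. Qed.
Lemma wpowS x : wpow (osucc x) = wpow x * omega. Proof. exact: ord_recS. Qed.

Lemma oadd_normal a : normal (oadd a).
Proof. by apply: ord_rec_normal => d; rewrite ord_recS; apply: olt_succ. Qed.

Lemma ole_addr a b : a <= a + b.
Proof. by rewrite -{1}[a]oaddx0; apply: normal_le (ole0x b); apply: oadd_normal. Qed.

Lemma oadd0x a : 0 + a = a.
Proof.
elim/ord_ind: a => [|a IH|l ll IH]; first exact: oaddx0.
  by rewrite oaddxS IH.
apply: ole_anti; last exact: (normal_ge l (oadd_normal 0)).
by apply: (proj2 (oadd_normal 0)) => // e el; rewrite IH //; apply: oltW.
Qed.

Lemma omul_normal a : 0 < a -> normal (omul a).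
Proof.
move=> a0; apply: ord_rec_normal => d; rewrite ord_recS.
by rewrite -{1}[ord_rec _ _ d]oaddx0; apply: (proj1 (oadd_normal _)).
Qed.

Lemma ofnat_lt m n : (m < n)%N -> ofnat m < ofnat n.
Proof.
elim: n => // n IH; rewrite ltnS leq_eqVlt => /orP[/eqP->|/IH h].
  exact: olt_succ.
exact: olt_trans h (olt_succ _).
Qed.

Lemma ofnat_lt_omega n : ofnat n < omega.
Proof.
apply: (olt_le_trans (olt_succ _)).
have [b Hb] := small_bounded ofnat.
by apply: (@osup_ub _ b) => [_ [k ->]|]; [apply/oltW|exists n.+1].
Qed.

Lemma lt_omega a : a < omega -> exists n, a = ofnat n.
Proof.
move=> aw; have [n] : exists n, a < ofnat n.
  apply: contrapT => /forallNP h; move/oltNge: aw; case.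
  by apply: osup_le => _ [n ->]; apply/oleNgt/h.
elim: n => [/oltx0//|n IH] /olt_succE/ole_eqVlt[->|/IH//]; by exists n.
Qed.

Lemma wpow_normal : normal wpow.
Proof.
have H1 : forall d, wpow d <= wpow (osucc d).
  move=> d; rewrite wpowS; case: (pselect (wpow d = 0)) => [->|/olt0x d0].
    exact: ole0x.
  rewrite -{1}[wpow d]oadd0x -(omulx0 (wpow d)) -omulxS.
  by apply: normal_le; [exact: omul_normal|apply/oltW/(ofnat_lt_omega 1)].
apply: ord_rec_normal => d.
have d0 : 0 < wpow d.
  apply: olt_le_trans (olt_succ 0) _; rewrite -[osucc 0]wpow0.
  exact: ord_rec_mono (ole0x d).
change (wpow d < wpow (osucc d)); rewrite wpowS.
rewrite -{1}[wpow d]oadd0x -(omulx0 (wpow d)) -omulxS.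
by apply: (proj1 (omul_normal d0)); apply: (ofnat_lt_omega 1).
Qed.

Lemma wpow_gt0 x : 0 < wpow x.
Proof.
apply: olt_le_trans (olt_succ 0) _; rewrite -[osucc 0]wpow0.
by apply: normal_le (ole0x x); apply: wpow_normal.
Qed.

Lemma oadd_sub a b : a <= b -> exists r, a + r = b.
Proof.
move=> ab; have [|r [h1 h2]] := normal_floor (oadd_normal a) (a := b).
  by rewrite oaddx0.
exists r; apply: ole_anti => //; move: h2; rewrite oaddxS.
by move/olt_succE.
Qed.

Lemma odiv a b : 0 < a -> exists q r, b = a * q + r /\ r < a.
Proof.
move=> a0; have [|q [h1 h2]] := normal_floor (omul_normal a0) (a := b).
  by rewrite omulx0; apply: ole0x.
have [r E] := oadd_sub h1; exists q, r; split=> //.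
by move: h2; rewrite omulxS -E; apply: normal_lt; apply: oadd_normal.
Qed.

(* A term list [:: (x_k, r_k); ...; (x_0, r_0)] stands for
   omega^x_k r_k + ... + omega^x_0 r_0. *)
Definition eval (l : seq (ord * nat)) : ord :=
  foldr (fun t r => wpow t.1 * ofnat t.2 + r) 0 l.

Definition ogtb : rel ord := fun a b => `[< b < a >].
Definition decreasing (s : seq ord) : bool := sorted ogtb s.
Definition exponents (l : seq (ord * nat)) : seq ord := [seq t.1 | t <- l].

Definition is_cnf (a : ord) (l : seq (ord * nat)) : Prop :=
  [/\ decreasing (exponents l), all (fun t => (0 < t.2)%N) l & a = eval l].

Lemma ogtb_trans : transitive ogtb.
Proof.
by move=> b a c /asboolP h1 /asboolP h2; apply/asboolP; apply: olt_trans h1.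
Qed.

Lemma ogtb_irr : irreflexive ogtb.
Proof. by move=> a; apply/asboolP/oltxx. Qed.

Lemma eval_lt x l : path ogtb x (exponents l) -> eval l < wpow x.
Proof.
elim: l x => [|[y n] l IH] x /=; first by move=> _; apply: wpow_gt0.
move=> /andP[/asboolP yx /IH h].
apply: (@olt_le_trans (wpow y * ofnat n.+1)).
  by rewrite omulxS; apply: (proj1 (oadd_normal _)).
apply: (@ole_trans (wpow (osucc y))).
  rewrite wpowS; apply: (normal_le (omul_normal (wpow_gt0 y))).
  exact/oltW/ofnat_lt_omega.
by apply: (normal_le wpow_normal); apply/osucc_le.
Qed.

Lemma eval_ge y n l : (0 < n)%N -> wpow y <= eval ((y, n) :: l).
Proof.
move=> n0; apply: (@ole_trans (wpow y * ofnat n)); last exact: ole_addr.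
rewrite -{1}[wpow y]oadd0x -(omulx0 (wpow y)) -omulxS.
apply: (normal_le (omul_normal (wpow_gt0 y))).
by apply/osucc_le; apply: (@ofnat_lt 0).
Qed.

Lemma cnf_exists a : exists l, is_cnf a l.
Proof.
elim/(well_founded_ind olt_wf): a => a IH.
case: (pselect (a = 0)) => [->|/olt0x a0]; first by exists [::].
have [|x [h1 h2]] := normal_floor wpow_normal (a := a).
  by rewrite wpow0; apply/osucc_le.
have [q [r [E rx]]] := odiv a (wpow_gt0 x).
have qw : q < omega.
  apply: (normal_lt (omul_normal (wpow_gt0 x))); rewrite -wpowS.
  by apply: ole_lt_trans h2; rewrite E; apply: ole_addr.
have [n En] := lt_omega qw.
have n0 : (0 < n)%N.
  case: n En => // En; move/oleNgt: h1; case.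
  by rewrite E En omulx0 oadd0x.
have [l [dl pl Er]] := IH r (olt_le_trans rx h1).
exists ((x, n) :: l); split=> /=; last by rewrite -Er -En.
  case: l dl pl Er => //= -[y m] l dl /andP[/= m0 _] Er; apply/andP; split=> //.
  apply/asboolP; apply: (normal_lt wpow_normal); apply: ole_lt_trans rx.
  by rewrite Er; apply: eval_ge.
by rewrite n0.
Qed.

Lemma eval_inj l1 l2 : decreasing (exponents l1) -> decreasing (exponents l2) ->
  all (fun t => (0 < t.2)%N) l1 -> all (fun t => (0 < t.2)%N) l2 ->
  eval l1 = eval l2 -> l1 = l2.
Proof.
elim: l1 l2 => [|[x n] l1 IH] [|[y m] l2] //.
- move=> _ _ _ /andP[/= m0 _] E; have /= := eval_ge y l2 m0.
  by rewrite -E => /oleNgt; case; apply: wpow_gt0.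
- move=> _ _ /andP[/= n0 _] _ E; have /= := eval_ge x l1 n0.
  by rewrite E => /oleNgt; case; apply: wpow_gt0.
move=> d1 d2 /andP[/= n0 p1] /andP[/= m0 p2] E.
have aux u k v j l l' : (0 < j)%N -> path ogtb u (exponents l) -> u < v ->
    eval ((u, k) :: l) <> eval ((v, j) :: l').
  move=> j0 pl uv; apply: olt_neq; apply: olt_le_trans (eval_ge v l' j0).
  by apply: eval_lt; rewrite /= pl andbT; apply/asboolP.
have aux2 u k j l l' : path ogtb u (exponents l) -> (k < j)%N ->
    eval ((u, k) :: l) <> eval ((u, j) :: l').
  move=> pl kj; apply: olt_neq; apply: olt_le_trans (ole_addr _ _) => /=.
  apply: (@olt_le_trans (wpow u * ofnat k.+1)).
    by rewrite omulxS; apply: (proj1 (oadd_normal _)); apply: eval_lt.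
  apply: (normal_le (omul_normal (wpow_gt0 u))).
  by move: kj; rewrite leq_eqVlt => /orP[/eqP->|/ofnat_lt/oltW //]; apply: olexx.
case: (oltgtP x y) => [xy|xy|yx].
- by case: (aux _ _ _ _ _ _ m0 d1 xy E).
- subst y; case: (ltngtP n m) => [h|h|h].
  + by case: (aux2 _ _ _ _ _ d1 h E).
  + by case: (aux2 _ _ _ _ _ d2 h (esym E)).
  + subst m; congr cons.
    apply: IH p1 p2 _; [exact: path_sorted d1|exact: path_sorted d2|].
    exact: normal_inj (oadd_normal _) E.
- by case: (aux _ _ _ _ _ _ n0 d2 yx (esym E)).
Qed.

Lemma cnf_unique a l1 l2 : is_cnf a l1 -> is_cnf a l2 -> l1 = l2.
Proof. by move=> [d1 p1 ->] [d2 p2 E]; apply: eval_inj. Qed.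

Definition cnf (a : ord) : seq (ord * nat) := projT1 (cid (cnf_exists a)).

Lemma cnfP a : is_cnf a (cnf a).
Proof. by rewrite /cnf; case: cid. Qed.

(* Meaningful for nonzero [a] only; the value at 0 is junk. *)
Definition smallest_exponent (a : ord) : ord := last 0 (exponents (cnf a)).

(* Natural sum. In the common list of terms [:: ...; (y_j, (r_j, s_j)); ...]
   the coefficients r_j and s_j may be zero. *)
Definition is_nadd (a b c : ord) : Prop :=
  exists l : seq (ord * (nat * nat)),
    [/\ decreasing [seq t.1 | t <- l],
        a = eval [seq (t.1, t.2.1) | t <- l],
        b = eval [seq (t.1, t.2.2) | t <- l]
      & c = eval [seq (t.1, (t.2.1 + t.2.2)%N) | t <- l]].

Definition coef (l : seq (ord * nat)) (x : ord) : nat :=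
  foldr (fun t n => if t.1 == x then t.2 + n else n)%N 0%N l.

Definition nz (l : seq (ord * nat)) := [seq t <- l | (0 < t.2)%N].

Lemma eval_nz l : eval (nz l) = eval l.
Proof.
elim: l => // -[x n] l IH /=; case: n => [|n] /=; last by rewrite IH.
by rewrite omulx0 oadd0x.
Qed.

Lemma coef_nz l : coef (nz l) =1 coef l.
Proof.
move=> x; elim: l => // -[y n] l IH /=; case: n => [|n] /=; last by rewrite IH.
by rewrite IH add0n if_same.
Qed.

Lemma decreasing_nz l : decreasing (exponents l) -> decreasing (exponents (nz l)).
Proof.
apply: subseq_sorted; first exact: ogtb_trans.
by apply: map_subseq; apply: filter_subseq.
Qed.

Lemma nz_pos l : all (fun t => (0 < t.2)%N) (nz l).
Proof. exact: filter_all. Qed.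

Lemma coef_notin l x : x \notin exponents l -> coef l x = 0%N.
Proof.
elim: l => // -[y n] l IH /=; rewrite inE negb_or => /andP[xy /IH ->].
by rewrite eq_sym (negbTE xy).
Qed.

Lemma mem_nz l t : decreasing (exponents l) ->
  (t \in nz l) = (0 < t.2)%N && (coef l t.1 == t.2).
Proof.
move=> dl; rewrite mem_filter; case: (ltnP 0 t.2) => //= t0.
elim: l dl => [|[y n] l IH] /= dl.
  by rewrite eq_sym; case: t.2 t0.
have ynl : y \notin exponents l.
  apply/negP => /(allP (order_path_min ogtb_trans dl)).
  by rewrite ogtb_irr.
rewrite inE; case: (eqVneq y t.1) => [E|ne].
  rewrite -E (coef_notin ynl) addn0.
  have /negbTE -> : t \notin l.
    apply: contra ynl => tl; rewrite E; exact: (map_f fst tl).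
  by rewrite orbF; case: t {t0 IH} E => [x k] /= ->; rewrite xpair_eqE eqxx eq_sym.
rewrite -IH; last exact: path_sorted dl.
by case: eqP => // E; rewrite E eqxx in ne.
Qed.

Lemma eval_coef l1 l2 : decreasing (exponents l1) -> decreasing (exponents l2) ->
  eval l1 = eval l2 <-> coef l1 =1 coef l2.
Proof.
move=> d1 d2; split=> E.
  move=> x; rewrite -(coef_nz l1) -(coef_nz l2); congr coef.
  by apply: eval_inj; rewrite ?nz_pos ?decreasing_nz ?eval_nz.
rewrite -(eval_nz l1) -(eval_nz l2); congr eval.
apply: (@irr_sorted_eq _ (fun s t => ogtb s.1 t.1)).
- by move=> t s u; apply: ogtb_trans.
- by move=> t; apply: ogtb_irr.
- by move/decreasing_nz: d1; rewrite /decreasing sorted_map.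
- by move/decreasing_nz: d2; rewrite /decreasing sorted_map.
- by move=> t; rewrite !mem_nz // E.
Qed.

Lemma coef_map (E : seq ord) (h : ord -> nat) x : uniq E ->
  coef [seq (y, h y) | y <- E] x = if x \in E then h x else 0%N.
Proof.
elim: E => //= y E IH /andP[yE /IH ->]; rewrite inE eq_sym.
by case: eqVneq => //= ->; rewrite (negbTE yE) addn0.
Qed.

Lemma nadd_exists a b : exists c, is_nadd a b c.
Proof.
have [la [da _ Ea]] := cnf_exists a; have [lb [db _ Eb]] := cnf_exists b.
pose geb x y := ogtb x y || (x == y).
pose E := sort geb (undup (exponents la ++ exponents lb)).
have uE : uniq E by rewrite sort_uniq undup_uniq.
have dE : decreasing E.
  have : sorted geb E.
    apply: sort_sorted => x y; case: (oltgtP x y) => [h|->|h].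
    - by rewrite /geb orbC (_ : ogtb y x = true) //; apply/asboolP.
    - by rewrite /geb eqxx orbT.
    - by rewrite /geb (_ : ogtb x y = true) //; apply/asboolP.
  rewrite /decreasing; elim: E uE => //= x [|y E] IH //= /andP[xE uE].
  move=> /andP[/orP[->|/eqP xy] h] /=; first exact: IH.
  by rewrite xy inE eqxx in xE.
have inE' x : (x \in E) = (x \in exponents la) || (x \in exponents lb).
  by rewrite mem_sort mem_undup mem_cat.
pose l := [seq (x, (coef la x, coef lb x)) | x <- E].
have mapE (h : ord -> nat) : exponents [seq (x, h x) | x <- E] = E.
  by rewrite /exponents -map_comp map_id.
exists (eval [seq (t.1, (t.2.1 + t.2.2)%N) | t <- l]), l; split=> //.
- by rewrite -map_comp map_id.
- rewrite Ea -map_comp; apply/eval_coef => //=; first by rewrite mapE.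
  move=> x; rewrite coef_map // inE'; case: (boolP (x \in exponents la)) => //= h.
  by rewrite coef_notin ?if_same.
- rewrite Eb -map_comp; apply/eval_coef => //=; first by rewrite mapE.
  move=> x; rewrite coef_map // inE' orbC.
  case: (boolP (x \in exponents lb)) => //= h.
  by rewrite coef_notin ?if_same.
Qed.

Lemma nadd_unique a b c d : is_nadd a b c -> is_nadd a b d -> c = d.
Proof.
move=> [l [dl al bl ->]] [m [dm am bm ->]].
have ex (k : seq (ord * (nat * nat))) (h : nat * nat -> nat) :
    exponents [seq (t.1, h t.2) | t <- k] = [seq t.1 | t <- k].
  by rewrite /exponents -map_comp.
have sumE (k : seq (ord * (nat * nat))) x :
    coef [seq (t.1, (t.2.1 + t.2.2)%N) | t <- k] x =
    (coef [seq (t.1, t.2.1) | t <- k] x + coef [seq (t.1, t.2.2) | t <- k] x)%N.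
  by elim: k => //= t k ->; case: eqP => // _; rewrite addnACA.
apply/eval_coef; rewrite ?(ex _ (fun p => p.1 + p.2)%N) // => x; rewrite !sumE.
move: al; rewrite am => /eval_coef.
rewrite !(ex _ fst) => /(_ dm dl) <-.
move: bl; rewrite bm => /eval_coef.
by rewrite !(ex _ snd) => /(_ dm dl) <-.
Qed.

Definition nadd (a b : ord) : ord := projT1 (cid (nadd_exists a b)).

Lemma naddP a b : is_nadd a b (nadd a b).
Proof. by rewrite /nadd; case: cid. Qed.

(* Sums over gamma < delta. A sequence of ordinals is a total function on
   [ord]; only its values below delta matter. *)
Definition osum (alpha : ord -> ord) (delta : ord) : ord :=
  ord_rec 0 (fun d r => r + alpha d) delta.

Definition nsum (alpha : ord -> ord) (delta : ord) : ord :=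
  ord_rec 0 (fun d r => nadd r (alpha d)) delta.

(* For d <= e, the unique eta with d + eta = e. *)
Definition osub (e d : ord) : ord := omin (fun eta => d + eta = e).

Lemma osubP d e : d <= e -> d + osub e d = e.
Proof. by move=> /oadd_sub /ominP[]. Qed.

Lemma osub_unique d e x : d + x = e -> x = osub e d.
Proof.
move=> E; apply: (normal_inj (oadd_normal d)); rewrite osubP // -E.
exact: ole_addr.
Qed.

(* Sums over d <= gamma < e. *)
Definition osum_from (alpha : ord -> ord) (d e : ord) : ord :=
  osum (fun eps => alpha (d + eps)) (osub e d).

Definition nsum_from (alpha : ord -> ord) (d e : ord) : ord :=
  nsum (fun eps => alpha (d + eps)) (osub e d).

(* Main.v *)
Require Import Defs.
From mathcomp Require Import all_boot.
From mathcomp Require Import boolp.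
Local Open Scope ord_scope.

(* Write N for [nsum alpha zeta] and [xi] for its smallest exponent, so that
   N = B + omega^xi with all exponents of B at least [xi]. The partial natural
   sums increase strictly to N, hence from some point on they are of the form
   B + r with r < omega^xi. On such ordinals adding a term naturally only
   changes r, so the natural sum of a tail is at most omega^xi; it dominates the
   ordinary sum of the tail. Conversely, whenever an ordinary transfinite sum is
   below a power of omega, so is the natural sum of the same sequence
   ([nsum_lt_wpow]). If the ordinary sum of the tail were below omega^xi, the
   natural sum of the tail would be as well, and N would be below
   B + omega^xi. *)

(** * Normal functions at limits and laws of ordinal addition *)

Lemma normal_cofinal f l a : normal f -> is_limit l -> a < f l ->
  exists2 e, e < l & a < f e.
Proof.
move=> nf ll al; apply: contrapT => h; move/oltNge: al; apply.
by apply: (proj2 nf) => // e el; apply/oleNgt => ae; apply: h; exists e.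
Qed.

Lemma normal_limit f l : normal f -> is_limit l -> is_limit (f l).
Proof.
move=> nf ll; split=> [E|b E].
  by have := proj1 nf 0 l (olt0x (proj1 ll)); rewrite E => /oltx0.
have [|e el /osucc_le] := @normal_cofinal f l b nf ll.
  by rewrite E; apply: olt_succ.
by rewrite -E => /oleNgt; apply; apply: (proj1 nf).
Qed.

Lemma ord_rec_cofinal z s l a : is_limit l -> a < ord_rec z s l ->
  exists2 e, e < l & a <= ord_rec z s e.
Proof.
move=> ll al; apply: contrapT => h; move/oltNge: al; apply.
apply: ord_recL_le => // e el; case: (ole_or_lt (ord_rec z s e) a) => // /oltW ae.
by case: h; exists e.
Qed.

Lemma ole_addl a b : b <= a + b.
Proof. exact: (normal_ge b (oadd_normal a)). Qed.

Lemma oaddA a b c : a + (b + c) = a + b + c.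
Proof.
elim/ord_ind: c => [|c IH|l ll IH]; first by rewrite !oaddx0.
  by rewrite !oaddxS IH.
apply: ole_anti.
  (* Once the right side is written as [a + r], the summand [a] cancels and the least-upper-bound
     property of [b + l] applies against [r]. *)
  have [|r Er] := @oadd_sub a (a + b + l).
    by apply: ole_trans (ole_addr _ _); apply: ole_addr.
  rewrite -Er; apply: normal_le; first exact: oadd_normal.
  apply: (proj2 (oadd_normal b)) => // e el.
  apply/oleNgt => /(proj1 (oadd_normal a)); rewrite Er IH //; apply/oleNgt.
  by apply: normal_le (oltW el); apply: oadd_normal.
apply: (proj2 (oadd_normal _)) => // e el; rewrite -IH //.
by do 2 (apply: normal_le; first exact: oadd_normal); apply: oltW.
Qed.

Lemma olt_add2l a b c : a + b < a + c <-> b < c.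
Proof.
by split; [apply: normal_lt (oadd_normal a)|apply: (proj1 (oadd_normal a))].
Qed.

Lemma ole_add2l a b c : a + b <= a + c <-> b <= c.
Proof.
split=> [/oleNgt h|]; last by apply: normal_le (oadd_normal a).
by apply/oleNgt => /olt_add2l.
Qed.

Lemma ole_add2r a b c : a <= b -> a + c <= b + c.
Proof.
move=> ab; elim/ord_ind: c => [|c IH|l ll IH]; first by rewrite !oaddx0.
  rewrite !oaddxS; apply/osucc_le; exact: ole_lt_trans IH (olt_succ _).
apply: (proj2 (oadd_normal _)) => // e el; apply: ole_trans (IH e el) _.
by apply/ole_add2l/oltW.
Qed.

(** * Natural addition through common lists of exponents *)

Lemma eval_cat l1 l2 : eval (l1 ++ l2) = eval l1 + eval l2.
Proof. by elim: l1 => [|t l IH] /=; rewrite ?oadd0x // IH oaddA. Qed.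

(** With the exponents fixed, an ordinal becomes a coefficient function, and natural addition
    becomes pointwise addition. *)
Definition ev (E : seq ord) (f : ord -> nat) : ord := eval [seq (y, f y) | y <- E].

Lemma exponents_map E (f : ord -> nat) : exponents [seq (y, f y) | y <- E] = E.
Proof. by rewrite /exponents -map_comp map_id. Qed.

(** The second clause keeps foreign exponents out of [E], so a bound on the members of [s] also
    bounds the exponents in [E]. *)
Lemma common_exponents (s : seq ord) : exists E, [/\ decreasing E,
  forall x, x \in E -> exists2 a, a \in s & x \in exponents (cnf a) &
  forall a, a \in s -> a = ev E (coef (cnf a))].
Proof.
(* Sorting needs a total relation, hence the reflexive [geb]; strict decrease is recovered from the
   absence of duplicates. *)
pose geb x y := ogtb x y || (x == y).
pose E := sort geb (undup (flatten [seq exponents (cnf a) | a <- s])).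
have uE : uniq E by rewrite sort_uniq undup_uniq.
have dE : decreasing E.
  have : sorted geb E.
    apply: sort_sorted => x y; case: (oltgtP x y) => [h|->|h].
    - by rewrite /geb orbC (_ : ogtb y x = true) //; apply/asboolP.
    - by rewrite /geb eqxx orbT.
    - by rewrite /geb (_ : ogtb x y = true) //; apply/asboolP.
  rewrite sorted_pairwise; last first.
    move=> y x z; rewrite /geb => /orP[xy|/eqP->//] /orP[yz|/eqP<-]; last by rewrite xy.
    by rewrite (ogtb_trans xy yz).
  rewrite /decreasing (sorted_pairwise ogtb_trans).
  elim: E uE => //= x E IH /andP[xE uE] /andP[/allP hx hE].
  rewrite IH // andbT; apply/allP => y yE; case/orP: (hx y yE) => // /eqP xy.
  by rewrite xy yE in xE.
exists E; split=> // [x|a sa].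
  by rewrite mem_sort mem_undup => /flatten_mapP[a sa xa]; exists a.
have [da pa {1}->] := cnfP a; apply/eval_coef; rewrite ?exponents_map // => x.
rewrite coef_map // mem_sort mem_undup.
case: flatten_mapP => // h; rewrite coef_notin //; apply/negP => xa.
by apply: h; exists a.
Qed.

Lemma common_exponents3 a b c : exists E f g h,
  [/\ decreasing E, a = ev E f, b = ev E g & c = ev E h].
Proof.
have [E [dE _ rE]] := common_exponents [:: a; b; c].
by exists E, (coef (cnf a)), (coef (cnf b)), (coef (cnf c)); split=> //;
  apply: rE; rewrite !inE eqxx ?orbT.
Qed.

Lemma naddE a b c : is_nadd a b c -> nadd a b = c.
Proof. exact: nadd_unique (naddP a b). Qed.

Lemma nadd_ev E f g : decreasing E ->
  nadd (ev E f) (ev E g) = ev E (fun y => f y + g y)%N.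
Proof.
move=> dE; apply: naddE; exists [seq (y, (f y, g y)) | y <- E].
by split; rewrite -map_comp //= map_id.
Qed.

Lemma eval_cons_lt x m n l l' : path ogtb x (exponents l) -> (m < n)%N ->
  eval ((x, m) :: l) < eval ((x, n) :: l').
Proof.
move=> pl mn; apply: olt_le_trans (ole_addr _ _) => /=.
apply: (@olt_le_trans (wpow x * ofnat m.+1)).
  by rewrite omulxS; apply: (proj1 (oadd_normal _)); apply: eval_lt.
apply: (normal_le (omul_normal (wpow_gt0 x))).
by move: mn; rewrite leq_eqVlt => /orP[/eqP->|/ofnat_lt/oltW //]; apply: olexx.
Qed.

(** Over a common list the order is lexicographic in the coefficients, and adding [h] preserves the
    first difference. *)
Lemma ev_lt_add E f g h : decreasing E -> ev E f < ev E g ->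
  ev E (fun y => f y + h y)%N < ev E (fun y => g y + h y)%N.
Proof.
elim: E => [|x E IH] dE; first by move/oltxx.
have pE k : path ogtb x (exponents [seq (y, k y) | y <- E]) by rewrite exponents_map.
rewrite /ev !map_cons; case: (ltngtP (f x) (g x)) => [fg _|gf|fg].
- by apply: eval_cons_lt; rewrite ?ltn_add2r.
- by move/oltW/oleNgt; case; apply: eval_cons_lt.
- by rewrite /= fg => /olt_add2l /IH lt; apply/olt_add2l/lt/(path_sorted dE).
Qed.

Lemma naddC a b : nadd a b = nadd b a.
Proof.
have [E [f [g [_ [dE -> -> _]]]]] := common_exponents3 a b 0; rewrite !nadd_ev //.
by congr (ev E); apply: funext => y; rewrite addnC.
Qed.

Lemma naddA a b c : nadd a (nadd b c) = nadd (nadd a b) c.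
Proof.
have [E [f [g [h [dE -> -> ->]]]]] := common_exponents3 a b c; rewrite !nadd_ev //.
by congr (ev E); apply: funext => y; rewrite addnA.
Qed.

Lemma naddx0 a : nadd a 0 = a.
Proof.
have [da _ Ea] := cnfP a.
apply: naddE; exists [seq (t.1, (t.2, 0%N)) | t <- cnf a].
rewrite -!map_comp; split=> //.
- by rewrite [LHS]Ea; congr eval; rewrite -[LHS]map_id; apply: eq_map => -[].
- by elim: (cnf a) => //= t l IH; rewrite -IH omulx0 oadd0x.
- rewrite [LHS]Ea; congr eval; rewrite -[LHS]map_id; apply: eq_map => -[x n] /=.
  by rewrite addn0.
Qed.

Lemma nadd_lt2r a b c : a < b -> nadd a c < nadd b c.
Proof.
have [E [f [g [h [dE -> -> ->]]]]] := common_exponents3 a b c; rewrite !nadd_ev //.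
exact: ev_lt_add.
Qed.

Lemma nadd_lt2l a b c : b < c -> nadd a b < nadd a c.
Proof. by rewrite !(naddC a); apply: nadd_lt2r. Qed.

Lemma nadd_le2r a b c : a <= b -> nadd a c <= nadd b c.
Proof. by case/ole_eqVlt => [->|/(nadd_lt2r _ _ c)/oltW//]; apply: olexx. Qed.

Lemma nadd_le2l a b c : b <= c -> nadd a b <= nadd a c.
Proof. by rewrite !(naddC a); apply: nadd_le2r. Qed.

Lemma nadd_ge a b : a <= nadd a b.
Proof. by rewrite -{1}[a]naddx0; apply/nadd_le2l/ole0x. Qed.

Lemma nadd_gt a b : b <> 0 -> a < nadd a b.
Proof. by move=> /olt0x b0; rewrite -{1}[a]naddx0; apply: nadd_lt2l. Qed.

(** By strict monotonicity, [nadd a] rises at each successor, while [oadd a] rises there by exactly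
    one and takes the least possible value at limits. *)
Lemma oadd_le_nadd a b : a + b <= nadd a b.
Proof.
elim/ord_ind: b => [|b IH|l ll IH]; first by rewrite oaddx0 naddx0; apply: olexx.
  rewrite oaddxS; apply/osucc_le; apply: ole_lt_trans IH _.
  exact/nadd_lt2l/olt_succ.
apply: (proj2 (oadd_normal _)) => // e el; apply: ole_trans (IH e el) _.
exact/nadd_le2l/oltW.
Qed.

(** * Natural addition below a power of omega *)

Lemma exponents_lt a x y : a < wpow x -> y \in exponents (cnf a) -> y < x.
Proof.
have [da pa Ea] := cnfP a; rewrite {1}Ea.
case: (cnf a) da pa => // -[z n] l /= dl /andP[/= n0 _] ax yl.
have zx : z < x.
  by apply: (normal_lt wpow_normal); apply: ole_lt_trans ax; apply: eval_ge.
move: yl; rewrite inE => /orP[/eqP->//|].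
by move/(allP (order_path_min ogtb_trans dl))/asboolP => yz; apply: olt_trans yz zx.
Qed.

Lemma path_ogtb x E : decreasing E -> (forall y, y \in E -> y < x) -> path ogtb x E.
Proof.
by case: E => //= y E dE h; rewrite dE andbT; apply/asboolP/h/mem_head.
Qed.

Lemma common_exponents_lt x a b : a < wpow x -> b < wpow x ->
  exists E f g, [/\ path ogtb x E, a = ev E f & b = ev E g].
Proof.
move=> ax bx; have [E [dE lE rE]] := common_exponents [:: a; b].
exists E, (coef (cnf a)), (coef (cnf b)); split.
- apply: path_ogtb => // y /lE[c]; rewrite !inE => /orP[]/eqP->; exact: exponents_lt.
- by apply: rE; rewrite inE eqxx.
- by apply: rE; rewrite !inE eqxx orbT.
Qed.

Lemma nadd_lt_wpow x a b : a < wpow x -> b < wpow x -> nadd a b < wpow x.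
Proof.
move=> ax bx; have [E [f [g [pE -> ->]]]] := common_exponents_lt x a b ax bx.
rewrite nadd_ev; last exact: path_sorted pE.
by apply: eval_lt; rewrite exponents_map.
Qed.

(** [B] is [a] with one copy of its last power of omega removed. All exponents of [B] are at least
    the smallest exponent, those of [r] and [s] lie below it, so the term lists concatenate. *)
Lemma smallest_exponentP a : a <> 0 -> exists B,
  a = B + wpow (smallest_exponent a) /\
  forall r s, r < wpow (smallest_exponent a) -> s < wpow (smallest_exponent a) ->
    nadd (B + r) s = B + nadd r s.
Proof.
rewrite /smallest_exponent; have [da pa {1 2}->] := cnfP a.
case/lastP: (cnf a) da pa => // l [x n].
rewrite /exponents map_rcons last_rcons all_rcons /=.
(* The last coefficient is [n.+1]; lowered to [n] it may become zero, which [eval] tolerates. *)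
case: n => // n dl _ _; exists (eval (rcons l (x, n))); split.
  by rewrite -!cats1 !eval_cat /= omulxS !oaddx0 oaddA.
move=> r s rx sx; have [E [f [g [pE -> ->]]]] := common_exponents_lt x r s rx sx.
rewrite nadd_ev; last exact: path_sorted pE.
apply: naddE; set l' := rcons l _.
exists ([seq (t.1, (t.2, 0%N)) | t <- l'] ++ [seq (y, (f y, g y)) | y <- E]).
rewrite !map_cat -!map_comp !eval_cat; split.
- rewrite /= map_id (_ : [seq _ | t <- l'] = rcons [seq t.1 | t <- l] x).
    rewrite cat_rcons; case: l dl {l'} => //= t l; rewrite rcons_path cat_path /=.
    by move=> /andP[-> ->] /=.
  by rewrite /l' map_rcons.
- by congr (eval _ + _); rewrite -[LHS]map_id; apply: eq_map => -[].
- rewrite (_ : eval _ = 0) ?oadd0x //.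
  by elim: l' => //= t k ->; rewrite omulx0 oadd0x.
- congr (eval _ + _); rewrite -[LHS]map_id; apply: eq_map => -[y m] /=.
  by rewrite addn0.
Qed.

(** * Partial sums and sums of tails *)

Lemma osum0 alpha : osum alpha 0 = 0. Proof. exact: ord_rec0. Qed.
Lemma nsum0 alpha : nsum alpha 0 = 0. Proof. exact: ord_rec0. Qed.
Lemma osumS alpha d : osum alpha (osucc d) = osum alpha d + alpha d.
Proof. exact: ord_recS. Qed.
Lemma nsumS alpha d : nsum alpha (osucc d) = nadd (nsum alpha d) (alpha d).
Proof. exact: ord_recS. Qed.

Lemma osum_mono alpha a b : a <= b -> osum alpha a <= osum alpha b.
Proof. by apply: ord_rec_mono => d; rewrite ord_recS; apply: ole_addr. Qed.

Lemma nsum_mono alpha a b : a <= b -> nsum alpha a <= nsum alpha b.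
Proof. by apply: ord_rec_mono => d; rewrite ord_recS; apply: nadd_ge. Qed.

Lemma osum_le_nsum alpha d : osum alpha d <= nsum alpha d.
Proof.
elim/ord_ind: d => [|d IH|l ll IH]; first by rewrite osum0; apply: ole0x.
  rewrite osumS nsumS; apply: ole_trans (oadd_le_nadd _ _).
  exact: ole_add2r.
apply: ord_recL_le => // e el; apply: ole_trans (IH e el) _.
exact/nsum_mono/oltW.
Qed.

Lemma osum_add alpha d h :
  osum alpha (d + h) = osum alpha d + osum (fun e => alpha (d + e)) h.
Proof.
elim/ord_ind: h => [|h IH|l ll IH]; first by rewrite osum0 !oaddx0.
  by rewrite oaddxS !osumS IH oaddA.
apply: ole_anti.
  apply: ord_recL_le => [|e]; first exact: normal_limit (oadd_normal d) ll.
  case/(normal_cofinal _ _ _ (oadd_normal d) ll) => h hl /oltW/(osum_mono alpha) eh.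
  by apply: ole_trans eh _; rewrite IH //; apply/ole_add2l/osum_mono/oltW.
have [|r Er] := @oadd_sub (osum alpha d) (osum alpha (d + l)).
  exact/osum_mono/ole_addr.
rewrite -Er; apply/ole_add2l/ord_recL_le => // e el.
by apply/(ole_add2l (osum alpha d)); rewrite Er -IH //; apply/osum_mono/ole_add2l/oltW.
Qed.

(* Only an inequality, since the natural sum is not continuous on the right. *)
Lemma nsum_add_le alpha d h :
  nsum alpha (d + h) <= nadd (nsum alpha d) (nsum (fun e => alpha (d + e)) h).
Proof.
elim/ord_ind: h => [|h IH|l ll IH].
- by rewrite nsum0 oaddx0 naddx0; apply: olexx.
- by rewrite oaddxS !nsumS naddA; apply: nadd_le2r.
apply: ord_recL_le => [|e]; first exact: normal_limit (oadd_normal d) ll.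
case/(normal_cofinal _ _ _ (oadd_normal d) ll) => h hl /oltW/(nsum_mono alpha) eh.
by apply: ole_trans eh _; apply: ole_trans (IH h hl) _; apply/nadd_le2l/nsum_mono/oltW.
Qed.

Lemma nsum_osum_le alpha d h :
  nsum alpha d + osum (fun e => alpha (d + e)) h <= nsum alpha (d + h).
Proof.
elim/ord_ind: h => [|h IH|l ll IH].
- by rewrite osum0 !oaddx0; apply: olexx.
- rewrite oaddxS osumS nsumS oaddA; apply: ole_trans (oadd_le_nadd _ _).
  exact: ole_add2r.
have [|r Er] := @oadd_sub (nsum alpha d) (nsum alpha (d + l)).
  exact/nsum_mono/ole_addr.
rewrite -Er; apply/ole_add2l/ord_recL_le => // e el.
apply/(ole_add2l (nsum alpha d)); rewrite Er; apply: ole_trans (IH e el) _.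
by apply/nsum_mono/ole_add2l/oltW.
Qed.

(** Induction on [d] for all [alpha] and [x] at once, since it is applied to tails and to smaller
    powers. At a limit, natural sums of the pieces starting at a suitable [e] stay below a fixed
    bound [n], so the whole is at most [nadd (nsum alpha e) n]. *)
Lemma nsum_lt_wpow alpha d x : osum alpha d < wpow x -> nsum alpha d < wpow x.
Proof.
elim/(well_founded_ind olt_wf): d alpha x => d IH alpha x.
case: (ord_cases d) => [->|[e Ed]|ld].
- by rewrite osum0 nsum0.
- rewrite Ed osumS nsumS => h; apply: nadd_lt_wpow.
    by apply: IH; [rewrite Ed; apply: olt_succ|apply: ole_lt_trans h; apply: ole_addr].
  exact: ole_lt_trans (ole_addl _ _) h.
move=> Ox.
have [e ed [n nx Hn]] : exists2 e, e < d & exists2 n, n < wpow x &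
    forall h, e + h < d -> nsum (fun i => alpha (e + i)) h <= n.
  have IHtail e h y : e + h < d -> osum (fun i => alpha (e + i)) h < wpow y ->
      nsum (fun i => alpha (e + i)) h < wpow y.
    by move=> ehd; apply: IH; apply: ole_lt_trans ehd; apply: ole_addl.
  (* If the ordinary sums are constant from [e] on, each piece has ordinary sum 0, below [wpow 0],
     which is 1; by induction its natural sum is 0 as well. *)
  case: (pselect (exists2 e, e < d & osum alpha d <= osum alpha e)) => [[e ed Ode]|h].
    exists e => //; exists 0; first exact: wpow_gt0.
    move=> h ehd; apply/olt_succE; rewrite -[osucc 0]wpow0; apply: IHtail => //.
    rewrite wpow0; apply/olt_succE/(ole_add2l (osum alpha e)).
    rewrite -osum_add oaddx0; apply: ole_trans Ode; exact/osum_mono/oltW.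
  have lt e : e < d -> osum alpha e < osum alpha d.
    by move=> ed; apply/oltNge => de; apply: h; exists e.
  (* Otherwise the partial sums increase strictly to [C + wpow y]. Once they have reached [C], every
     further piece has ordinary sum below [wpow y], and [wpow y] is itself below [wpow x]. *)
  have [|C [EC _]] := smallest_exponentP (osum alpha d).
    by move=> E0; have := lt 0 (olt0x (proj1 ld)); rewrite E0 => /oltx0.
  set y := smallest_exponent _ in EC.
  have [|e ed Ce] := ord_rec_cofinal 0 (fun d r => r + alpha d) d C ld.
    change (C < osum alpha d); rewrite EC -{1}[C]oaddx0; exact/olt_add2l/wpow_gt0.
  exists e => //; exists (wpow y).
    by apply: ole_lt_trans Ox; rewrite EC; apply: ole_addl.
  move=> k ekd; apply/oltW/IHtail => //; apply/(olt_add2l C); rewrite -EC.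
  by apply: ole_lt_trans (lt _ ekd); rewrite osum_add; apply: ole_add2r.
apply: (@ole_lt_trans (nadd (nsum alpha e) n)); last first.
  apply: nadd_lt_wpow => //; apply: IH => //; apply: ole_lt_trans Ox.
  exact/osum_mono/oltW.
apply: ord_recL_le => // k kd; case: (ole_or_lt e k) => [/oadd_sub[h Eh]|/oltW ke].
  rewrite -Eh in kd *; apply: ole_trans (nsum_add_le alpha e h) _.
  exact/nadd_le2l/Hn.
exact: ole_trans (nsum_mono alpha _ _ ke) (nadd_ge _ _).
Qed.

Theorem theorem3p7 (zeta : ord) (alpha : ord -> ord)
    (zeta_limit : is_limit zeta)
    (alpha_not_ev0 : forall delta, delta < zeta ->
       exists gamma, [/\ delta <= gamma, gamma < zeta & alpha gamma <> 0]) :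
  nsum alpha zeta <> 0 /\
  let xi := smallest_exponent (nsum alpha zeta) in
  exists2 gbar, gbar < zeta &
    forall eps, gbar <= eps -> eps < zeta ->
      [/\ nsum_from alpha eps zeta = osum_from alpha eps zeta,
          osum_from alpha eps zeta = wpow xi
        & nsum alpha zeta = nsum alpha eps + wpow xi].
Proof.
have lt d : d < zeta -> nsum alpha d < nsum alpha zeta.
  move=> /alpha_not_ev0[g [dg gz ag]].
  apply: ole_lt_trans (nsum_mono alpha _ _ dg) _.
  apply: (@olt_le_trans (nsum alpha (osucc g))); first by rewrite nsumS; apply: nadd_gt.
  exact/nsum_mono/osucc_le.
have n0 : nsum alpha zeta <> 0.
  by move=> E; have := lt 0 (olt0x (proj1 zeta_limit)); rewrite E => /oltx0.
split=> // xi; have [B [EB HB]] := smallest_exponentP _ n0; rewrite -/xi in EB HB.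
have BS : B < nsum alpha zeta.
  by rewrite EB -{1}[B]oaddx0; apply/olt_add2l/wpow_gt0.
have [g gz Bg] := ord_rec_cofinal _ _ _ _ zeta_limit BS.
exists g => // eps geps epsz; set h := osub zeta eps.
have Eh : eps + h = zeta by apply/osubP/oltW.
have lh : is_limit h.
  split=> [h0|k hk]; first by move/olt_neq: epsz; rewrite -Eh h0 oaddx0.
  by apply: (proj2 zeta_limit (eps + k)); rewrite -oaddxS -hk.
have Beps : B <= nsum alpha eps by apply: ole_trans Bg (nsum_mono _ _ _ geps).
have decomp k : k < h ->
    exists2 r, nsum alpha (eps + k) = B + r & r < wpow xi.
  move=> kh; have [|r Er] := @oadd_sub B (nsum alpha (eps + k)).
    by apply: ole_trans Beps _; apply/nsum_mono/ole_addr.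
  exists r => //; apply/(olt_add2l B); rewrite Er -EB; apply: lt.
  by rewrite -Eh; apply/olt_add2l.
have h0 : 0 < h by apply: olt0x (proj1 lh).
have [rho] := decomp 0 h0; rewrite oaddx0 => Erho rhox.
pose beta i := alpha (eps + i).
(* Past [B] each natural addition acts on the remainder alone. At limits the inequality survives
   because [B] can be cancelled before taking the supremum. *)
have low k : k < h -> B + nsum beta k <= nsum alpha (eps + k).
  elim/ord_ind: k => [|k IH|l ll IH] kh.
  - by rewrite nsum0 !oaddx0.
  - have kh' : k < h by apply: olt_trans (olt_succ k) kh.
    have [r Er rx] := decomp k kh'; have [r' Er' rx'] := decomp _ kh.
    rewrite oaddxS nsumS in Er' *; rewrite nsumS.
    (* [B + alpha (eps + k)] is at most the next partial sum [B + r']. *)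
    have ax : alpha (eps + k) < wpow xi.
      apply: ole_lt_trans rx'; apply/(ole_add2l B); rewrite -Er'.
      apply: ole_trans (oadd_le_nadd _ _) _; apply: nadd_le2r.
      by rewrite Er; apply: ole_addr.
    rewrite Er HB //; apply/ole_add2l/nadd_le2r/(ole_add2l B).
    by rewrite -Er; apply: IH.
  - have [r Er rx] := decomp l kh; rewrite Er; apply/ole_add2l/ord_recL_le => // e el.
    apply/(ole_add2l B); rewrite -Er.
    apply: ole_trans (IH e el (olt_trans el kh)) _.
    by apply/nsum_mono/ole_add2l/oltW.
have up : nsum beta h <= wpow xi.
  apply: ord_recL_le => // k kh; apply/oltW/(olt_add2l B); rewrite -EB.
  by apply: ole_lt_trans (low k kh) (lt _ _); rewrite -Eh; apply/olt_add2l.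
have down : wpow xi <= osum beta h.
  (* Otherwise the total would be at most [B + nadd rho (nsum beta h)], where both arguments of
     [nadd] lie below [wpow xi]. *)
  apply/oleNgt => /nsum_lt_wpow Nx; have := nsum_add_le alpha eps h.
  rewrite Eh EB Erho HB // => /ole_add2l /oleNgt; apply; exact: nadd_lt_wpow.
have ON := osum_le_nsum beta h.
rewrite /nsum_from /osum_from -/h -/beta.
have Oxi : osum beta h = wpow xi by apply: ole_anti => //; apply: ole_trans up.
split=> //; first by rewrite Oxi; apply: ole_anti => //; apply: ole_trans ON.
(* One direction uses that [B] is at most [nsum alpha eps]; the other appends the ordinary sum of
   the tail, already known to be [wpow xi]. *)
apply: ole_anti; first by rewrite EB; apply: ole_add2r.
by rewrite -Oxi -Eh; apply: nsum_osum_le.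
Qed.
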